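(* Let $g:\mathbb{R}\to\mathbb{R}$ be a concave function. Then the following assertions are equivalent: (i) There exists a separately convex function $f:\mathbb{R}^2\to\mathbb{R}$ such that $f(u,u)=g(u)$ for each $u\in\mathbb{R}$. (ii) The function $$x\;\mapsto\;\int_0^1\frac{g(x+t)+g(x-t)-2g(x)}{t^2}\,dt$$ is locally bounded from below (i.e. bounded from below on every bounded subset of $\mathbb{R}$).
   Context: A function $f:\mathbb{R}^d\to\mathbb{R}$ is called separately convex if it is convex on every line parallel to a coordinate axis. *)

(* Defs.v *)
From mathcomp Require Import all_boot all_order all_algebra.
From mathcomp Require Import all_classical all_reals all_analysis.
Set Implicit Arguments. Unset Strict Implicit. Unset Printing Implicit Defensive.
Import Order.TTheory GRing.Theory Num.Theory.
Local Open Scope ring_scope.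

Definition convex_on_R (R : realType) (h : R -> R) : Prop :=
  forall (x y l : R), 0 <= l -> l <= 1 ->
    h (l * x + (1 - l) * y) <= l * h x + (1 - l) * h y.

Definition concave_on_R (R : realType) (h : R -> R) : Prop :=
  forall (x y l : R), 0 <= l -> l <= 1 ->
    l * h x + (1 - l) * h y <= h (l * x + (1 - l) * y).

Definition separately_convex (R : realType) (f : R * R -> R) : Prop :=
  (forall y : R, convex_on_R (fun x => f (x, y))) /\
  (forall x : R, convex_on_R (fun y => f (x, y))).

(* x |-> \int_0^1 (g(x+t)+g(x-t)-2g(x))/t^2 dt, as an extended real
   Lebesgue integral (the integrand is <= 0 for concave g, so the value
   lies in [-oo, 0]). *)
Definition second_diff_integral (R : realType) (g : R -> R) (x : R) : \bar R :=
  (\int[@lebesgue_measure R]_(t in `[0%R, 1%R]%classic)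
      ((g (x + t) + g (x - t) - 2 * g x) / (t ^+ 2))%:E)%E.

Definition locally_bounded_below (R : realType) (F : R -> \bar R) : Prop :=
  forall B : set R, (exists r : R, forall x, B x -> `|x| <= r) ->
    exists M : R, forall x, B x -> (M%:E <= F x)%E.

(* Main.v *)
(** Write [a_x(t) = 2 g(x) - g(x+t) - g(x-t)], which is nonnegative and
    nondecreasing in [t >= 0]. Splitting [0, 1] into dyadic intervals, (ii) says
    that the sums of [2^k a_x(2^-k)] are bounded locally uniformly in [x].

    If [f] is separately convex with trace [g], put
    [b(t) = f(x+t, x-t) + f(x-t, x+t) - 2 g(x)]. Averaging over the corners of a
    square gives [a_x(t) <= b(t)], and moving from the antidiagonal at scale [t]
    to the one at scale [2t] by horizontal and vertical steps gives
    [b(t)/t + a_x(t)/(3t) <= b(2t)/(2t)]; these inequalities telescope.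

    Conversely, [f] is obtained as a supremum of separately convex functions that
    lie below [g] on the diagonal and nearly touch it at a given point [u]. They
    are built from the function equal to [-xy] on [[-1,1]^2] and to [|x-y| - 1]
    elsewhere, which is separately convex: rescaled to size [2^-k] around [u] and
    weighted by [4 a_u(2^-k)], it pushes the diagonal values below [g] at distance
    about [2^-k] from [u], at a cost of order [2^k a_u(2^-k) |x-y|] off the
    diagonal. The bilinear term [-M(u) (x-u)(y-u)] makes the functions attached to
    remote points [u] irrelevant, and a locally finite sum of truncated saddles
    reduces the problem to a trace that is bounded below. *)

Require Import Defs.
From mathcomp Require Import all_boot all_order all_algebra.
From mathcomp Require Import all_classical all_reals all_analysis.
From mathcomp Require Import measurable_realfun.
From mathcomp Require Import ring lra.
Import Order.TTheory GRing.Theory Num.Theory.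
Import numFieldNormedType.Exports.
Local Open Scope ring_scope.
Set Implicit Arguments.
Unset Strict Implicit.
Unset Printing Implicit Defensive.

(** * Convex functions on the line *)

Lemma convex_affine (R : realType) (p c : R) :
  convex_on_R (fun x => p * x + c).
Proof. by move=> x y l _ _; lra. Qed.

Lemma convexD (R : realType) (h k : R -> R) :
  convex_on_R h -> convex_on_R k -> convex_on_R (fun x => h x + k x).
Proof.
move=> ch ck x y l l0 l1; have := ch x y l l0 l1; have := ck x y l l0 l1; lra.
Qed.

Lemma convexZ (R : realType) (c : R) (h : R -> R) : 0 <= c ->
  convex_on_R h -> convex_on_R (fun x => c * h x).
Proof.
move=> c0 ch x y l l0 l1; have := ler_wpM2l c0 (ch x y l l0 l1); lra.
Qed.

Lemma convex_max (R : realType) (h k : R -> R) :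
  convex_on_R h -> convex_on_R k ->
  convex_on_R (fun x => Num.max (h x) (k x)).
Proof.
move=> ch ck x y l l0 l1; rewrite ge_max; apply/andP; split.
- apply: (le_trans (ch x y l l0 l1)).
  by apply: lerD; apply: ler_wpM2l; rewrite ?subr_ge0// le_max lexx.
- apply: (le_trans (ck x y l l0 l1)).
  by apply: lerD; apply: ler_wpM2l; rewrite ?subr_ge0// le_max lexx orbT.
Qed.

Lemma convex_comp_affine (R : realType) (p c : R) (h : R -> R) :
  convex_on_R h -> convex_on_R (fun x => h (p * x + c)).
Proof.
move=> ch x y l l0 l1.
have -> : p * (l * x + (1 - l) * y) + c
  = l * (p * x + c) + (1 - l) * (p * y + c) by ring.
exact: ch.
Qed.

Lemma convex_sum (R : realType) (I : Type) (r : seq I) (h : I -> R -> R) :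
  (forall i, convex_on_R (h i)) -> convex_on_R (fun x => \sum_(i <- r) h i x).
Proof.
move=> ch x y l l0 l1; rewrite !mulr_sumr -big_split /=.
by apply: ler_sum => i _; apply: ch.
Qed.

Lemma eq_convex (R : realType) (h k : R -> R) :
  h =1 k -> convex_on_R h -> convex_on_R k.
Proof. by move=> e ch x y l l0 l1; rewrite -!e; apply: ch. Qed.

Lemma convex_dist (R : realType) (y : R) : convex_on_R (fun x => `|x - y|).
Proof.
apply: (eq_convex (h := fun x => Num.max (1 * x + - y) (-1 * x + y))).
  move=> x; have -> : -1 * x + y = - (x - y) by ring.
  rewrite mul1r; have [xy|xy] := lerP 0 (x - y).
    by rewrite max_l ?ger0_norm//; lra.
  by rewrite max_r ?ltr0_norm//; lra.
by apply: convex_max; apply: convex_affine.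
Qed.

Lemma concave_opp (R : realType) (g : R -> R) :
  concave_on_R g -> convex_on_R (fun x => - g x).
Proof. by move=> cg x y l l0 l1; have := cg x y l l0 l1; lra. Qed.

Lemma convex_segment (R : realType) (h : R -> R) (a b x : R) :
  convex_on_R h -> a <= x -> x <= b -> a < b ->
  (b - a) * h x <= (b - x) * h a + (x - a) * h b.
Proof.
move=> ch ax xb ab; have d0 : 0 < b - a by rewrite subr_gt0.
have l0 : 0 <= (b - x) / (b - a).
  by apply: divr_ge0; rewrite subr_ge0// ltW.
have l1 : (b - x) / (b - a) <= 1 by rewrite ler_pdivrMr// mul1r; lra.
have e : (b - x) / (b - a) * a + (1 - (b - x) / (b - a)) * b = x.
  by field; rewrite gt_eqF.
have := ch a b _ l0 l1; rewrite e => /(ler_wpM2l (ltW d0)).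
have -> : (b - a) * ((b - x) / (b - a) * h a + (1 - (b - x) / (b - a)) * h b)
   = (b - x) * h a + (x - a) * h b by field; rewrite gt_eqF.
by [].
Qed.

Lemma convex_le_max (R : realType) (h : R -> R) (a b x : R) :
  convex_on_R h -> a <= x -> x <= b -> h x <= Num.max (h a) (h b).
Proof.
move=> ch ax xb; have [ab|ba] := ltP a b; last first.
  have -> : x = a by apply/eqP; rewrite eq_le ax (le_trans xb ba).
  by rewrite le_max lexx.
have d0 : 0 < b - a by rewrite subr_gt0.
rewrite -(ler_pM2l d0); apply: (le_trans (convex_segment ch ax xb ab)).
set m := Num.max _ _.
have am : (b - x) * h a <= (b - x) * m.
  by rewrite ler_wpM2l ?subr_ge0// le_max lexx.
have bm : (x - a) * h b <= (x - a) * m.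
  by rewrite ler_wpM2l ?subr_ge0// le_max lexx orbT.
lra.
Qed.

(** The endpoint values bound [h] above; convexity at [0], the midpoint of [x] and [- x], turns this
    into a lower bound. *)
Lemma convex_bounded (R : realType) (h : R -> R) (r : R) : convex_on_R h ->
  exists K, forall x, `|x| <= r -> `|h x| <= K.
Proof.
move=> ch; set m := Num.max (h (- r)) (h r).
have up x : `|x| <= r -> h x <= m.
  by rewrite ler_norml => /andP[]; apply: convex_le_max.
exists (2 * `|h 0| + `|m|) => x xr; have A := up _ xr.
have B : h (- x) <= m by apply: up; rewrite normrN.
have := ch x (- x) 2^-1; have -> : 2^-1 * x + (1 - 2^-1) * - x = 0 by lra.
have := ler_norm (- h 0); have := normr_ge0 (h 0); have := ler_norm m.
by rewrite normrN ler_norml; lra.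
Qed.

(** The slope at [u] is the supremum of the slopes of chords ending at [u] from the left; chords
    leaving to the right are at least as steep. *)
Lemma convex_subgradient (R : realType) (h : R -> R) : convex_on_R h ->
  exists p : R -> R, forall u v, h u + p u * (v - u) <= h v.
Proof.
move=> ch; suff /choice[p Hp] : forall u, exists p, forall v,
    h u + p * (v - u) <= h v by exists p.
move=> u; pose S : set R := fun q => exists2 v, v < u & q * (u - v) = h u - h v.
have Sne : (S !=set0)%classic.
  exists (h u - h (u - 1)), (u - 1); first by lra.
  by ring.
have key v w q : u < w -> v < u -> q * (u - v) = h u - h v ->
    q * (w - u) <= h w - h u.
  move=> uw vu e; have vw : v < w by lra.
  have := convex_segment ch (ltW vu) (ltW uw) vw => H.
  have uv0 : 0 < u - v by lra.
  rewrite -(ler_pM2l uv0).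
  have -> : (u - v) * (q * (w - u)) = (q * (u - v)) * (w - u) by ring.
  by rewrite e; lra.
have Sub : has_ubound S.
  exists (h (u + 1) - h u) => q [v vu e].
  have := key v (u + 1) q; have -> : u + 1 - u = 1 by ring.
  by rewrite mulr1; apply => //; lra.
exists (sup S) => v; have [uv|vu|->] := ltgtP u v.
- have : sup S <= (h v - h u) / (v - u).
    apply: ge_sup => // q [w wu e].
    by rewrite ler_pdivlMr ?subr_gt0//; apply: key e.
  by rewrite ler_pdivlMr ?subr_gt0//; lra.
- have : (h u - h v) / (u - v) <= sup S.
    apply: ub_le_sup => //; exists v => //.
    by field; rewrite subr_eq0 gt_eqF.
  by rewrite ler_pdivrMr ?subr_gt0//; lra.
- by rewrite subrr mulr0 addr0.
Qed.

Lemma subgradient_bounded (R : realType) (h p : R -> R) (r : R) :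
  convex_on_R h -> (forall u v, h u + p u * (v - u) <= h v) ->
  exists K, forall u, `|u| <= r -> `|p u| <= K.
Proof.
move=> ch Hp; have [K HK] := convex_bounded (r + 1) ch.
exists (2 * K) => u ur; have := Hp u (u + 1); have := Hp u (u - 1).
have /HK : `|u| <= r + 1 by lra.
have /HK : `|u + 1| <= r + 1 by have := ler_normD u 1; rewrite normr1; lra.
have /HK : `|u - 1| <= r + 1 by have := ler_normB u 1; rewrite normr1; lra.
by rewrite !ler_norml; lra.
Qed.

(** Supporting lines at [x] and at [y] enclose [h x - h y], and their slopes are bounded near
    [x]. *)
Lemma convex_continuous (R : realType) (h : R -> R) :
  convex_on_R h -> continuous h.
Proof.
move=> ch x; have [p Hp] := convex_subgradient ch.
have [K Bp] := subgradient_bounded (`|x| + 1) ch Hp.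
have K0 : 0 <= K by apply: le_trans (Bp x _); rewrite ?normr_ge0// lerDl.
apply/cvgrPdist_le => e e0; near=> y.
have yx : `|x - y| <= 1 by near: y; apply: cvgr_dist_le.
have ye : `|x - y| <= e / (K + 1).
  by near: y; apply: cvgr_dist_le => //; apply: divr_gt0 => //; lra.
have {}ye : (K + 1) * `|x - y| <= e.
  by rewrite mulrC -ler_pdivlMr//; lra.
have Bx : `|p x| <= K by apply: Bp; lra.
have By : `|p y| <= K.
  by apply: Bp; have := ler_normB x (x - y); rewrite subKr; lra.
have P1 := Hp x y; have P2 := Hp y x.
have Q1 : `|p x * (x - y)| <= K * `|x - y| by rewrite normrM ler_wpM2r.
have Q2 : `|p y * (x - y)| <= K * `|x - y| by rewrite normrM ler_wpM2r.
by move: Q1 Q2; rewrite !ler_norml; have := normr_ge0 (x - y); lra.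
Unshelve. all: by end_near.
Qed.

(** * Second differences and the dyadic form of (ii) *)

Definition diff2 (R : realType) (g : R -> R) (x t : R) : R :=
  2 * g x - g (x + t) - g (x - t).

Definition dyad (R : realType) (k : nat) : R := 2^-1 ^+ k.

Definition dyadic_sum (R : realType) (g : R -> R) (x : R) (n : nat) : R :=
  \sum_(k < n) diff2 g x (dyad R k) / dyad R k.

Lemma dyad_gt0 (R : realType) (k : nat) : 0 < dyad R k.
Proof. by rewrite exprn_gt0// invr_gt0. Qed.

Lemma dyadS (R : realType) (k : nat) : dyad R k = 2 * dyad R k.+1.
Proof. by rewrite /dyad exprS mulrA divff ?mul1r. Qed.

Lemma dyad_le (R : realType) (m n : nat) : (m <= n)%N -> dyad R n <= dyad R m.
Proof. by move=> mn; apply: ler_wiXn2l => //; lra. Qed.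

Lemma dyad_le1 (R : realType) (k : nat) : dyad R k <= 1.
Proof. exact: (@dyad_le R 0). Qed.

Lemma dyad_lt (R : realType) (t : R) : 0 < t -> exists k, dyad R k < t.
Proof.
move=> t0; exists (Num.bound t^-1); rewrite /dyad exprVn.
rewrite invf_plt ?posrE ?exprn_gt0//.
exact: upper_nthrootP.
Qed.

Lemma dyad_between (R : realType) (n : nat) (t : R) : t <= 1 -> dyad R n < t ->
  exists2 k, (k < n)%N & dyad R k.+1 < t <= dyad R k.
Proof.
move=> t1; elim: n => [|n IH] tn; first by rewrite /dyad expr0 ltNge t1 in tn.
have [tn'|tn'] := leP t (dyad R n); first by exists n; rewrite ?tn ?tn'.
by have [k kn Hk] := IH tn'; exists k => //; apply: leqW.
Qed.

(** Adding the chord inequalities for [- g] on [[x, x + t]] and [[x - t, x]] shows that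
    [diff2 g x t / t] is nondecreasing. *)
Lemma diff2_scale (R : realType) (g : R -> R) (x s t : R) : concave_on_R g ->
  0 <= s -> s <= t -> 0 < t -> t * diff2 g x s <= s * diff2 g x t.
Proof.
move=> /concave_opp cg s0 st t0.
have A : (x + t - x) * - g (x + s) <=
   (x + t - (x + s)) * - g x + (x + s - x) * - g (x + t).
  by apply: (convex_segment cg); lra.
have B : (x - (x - t)) * - g (x - s) <=
   (x - (x - s)) * - g (x - t) + (x - s - (x - t)) * - g x.
  by apply: (convex_segment cg); lra.
by rewrite /diff2; lra.
Qed.

Lemma diff2_ge0 (R : realType) (g : R -> R) (x t : R) : concave_on_R g ->
  0 <= diff2 g x t.
Proof.
move=> cg; have := cg (x + t) (x - t) 2^-1.
have -> : 2^-1 * (x + t) + (1 - 2^-1) * (x - t) = x by lra.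
by rewrite /diff2; lra.
Qed.

Lemma diff2_le (R : realType) (g : R -> R) (x s t : R) : concave_on_R g ->
  0 <= s -> s <= t -> diff2 g x s <= diff2 g x t.
Proof.
move=> cg s0 st; have [t0|t0] := leP t 0.
  by have -> : s = t by lra.
rewrite -(ler_pM2l t0); apply: (le_trans (diff2_scale x cg s0 st t0)).
by apply: ler_wpM2r => //; apply: diff2_ge0.
Qed.

(** * Splitting the integral over dyadic intervals *)

Definition dyad_itv (R : realType) (k : nat) : set R :=
  `](dyad R k.+1), (dyad R k)]%classic.
Arguments dyad_itv : clear implicits.

Definition quot2 (R : realType) (g : R -> R) (x t : R) : R :=
  diff2 g x t / t ^+ 2.

Lemma bigcup_dyad_itv (R : realType) :
  (\bigcup_k dyad_itv R k = `]0%R, 1%R])%classic.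
Proof.
apply/seteqP; split=> [t [k _]|t] /=.
  rewrite /dyad_itv /= !in_itv/= => /andP[kt tk].
  by rewrite (lt_trans (dyad_gt0 _ _) kt) (le_trans tk (dyad_le1 _ _)).
rewrite in_itv/= => /andP[t0 t1]; have [n nt] := dyad_lt t0.
by have [k _ kt] := dyad_between t1 nt; exists k => //;
  rewrite /dyad_itv /= in_itv.
Qed.

Lemma trivIset_dyad_itv (R : realType) :
  trivIset [set: nat]%classic (dyad_itv R).
Proof.
apply: ltn_trivIset => n m mn; apply/seteqP; split=> // t [] /=.
rewrite /dyad_itv /= !in_itv/= => /andP[mt _] /andP[_ tn].
have := @dyad_le R _ _ mn.
by move=> H; have := lt_le_trans mt (le_trans tn H); rewrite ltxx.
Qed.

Lemma measurable_quot2 (R : realType) (g : R -> R) (x : R) (D : set R) :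
  concave_on_R g -> measurable D -> (forall t, D t -> 0 < t) ->
  measurable_fun D (fun t => (quot2 g x t)%:E).
Proof.
move=> cg mD D0; apply/measurable_EFinP.
suff : measurable_fun (`]0%R, +oo[%classic : set R) (quot2 g x).
  apply: measurable_funS => //.
  by move=> t /D0 /= t0; rewrite in_itv/= t0.
apply: open_continuous_measurable_fun; first exact: interval_open.
move=> t; rewrite inE/= in_itv/= andbT => t0.
have cong : continuous g.
  have H := convex_continuous (concave_opp cg).
  have -> : g = (fun y => - (- g y)) by apply/funext => y; rewrite opprK.
  by move=> y; apply: cvgN; apply: H.
apply: cvgM; last first.
  apply: cvgV; first by rewrite expf_neq0// gt_eqF.
  exact: exprn_continuous.
apply: cvgB; first apply: cvgB.
- exact: cvg_cst.
- apply: (continuous_comp (f := fun t => x + t)); last exact: cong.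
  by apply: cvgD; [exact: cvg_cst|exact: cvg_id].
- apply: (continuous_comp (f := fun t => x - t)); last exact: cong.
  by apply: cvgB; [exact: cvg_cst|exact: cvg_id].
Qed.

Lemma second_diff_integralE (R : realType) (g : R -> R) (x : R) :
  concave_on_R g ->
  second_diff_integral g x = (- \sum_(0 <= k <oo)
    \int[@lebesgue_measure R]_(t in dyad_itv R k) (quot2 g x t)%:E)%E.
Proof.
move=> cg; have q0 t : (0 <= (quot2 g x t)%:E)%E.
  by rewrite lee_fin divr_ge0 ?diff2_ge0 ?sqr_ge0.
rewrite /second_diff_integral.
transitivity (\int[@lebesgue_measure R]_(t in `[0%R, 1%R]%classic)
  (- (quot2 g x t)%:E))%E.
  apply: eq_integral => t _; rewrite -EFinN; congr EFin.
  by rewrite /quot2 -[RHS]mulNr /diff2; congr (_ / _); ring.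
rewrite integral_ge0N//; congr (- _)%E.
(* The dyadic intervals only cover []0, 1]], so the null point [0] is removed first. *)
rewrite -integral_itv_obnd_cbnd; last first.
  apply: measurable_quot2 => // t /=.
  by rewrite in_itv/= => /andP[].
rewrite -bigcup_dyad_itv ge0_integral_bigcup//.
- by move=> k; apply: measurable_itv.
- rewrite bigcup_dyad_itv; apply: measurable_quot2 => // t /=.
  by rewrite in_itv/= => /andP[].
- exact: trivIset_dyad_itv.
Qed.

Lemma integral_dyad_itv_cst (R : realType) (k : nat) (c : R) :
  (\int[@lebesgue_measure R]_(t in dyad_itv R k) (cst c%:E t) =
   (c * dyad R k.+1)%:E)%E.
Proof.
rewrite integral_cst; last exact: measurable_itv.
have d0 := dyad_gt0 R k.+1.
rewrite EFinM; congr (_ * _)%E.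
apply: etrans (lebesgue_measure_itv _) _.
rewrite /= lte_fin (dyadS R k) ifT; last by lra.
by rewrite -EFinB; congr EFin; ring.
Qed.

(** On an interval of length [dyad R k.+1], the numerator is at least its value at the left end and
    [t ^+ 2] is at most [4 * dyad R k.+1 ^+ 2]. *)
Lemma integral_dyad_itv_ge (R : realType) (g : R -> R) (x : R) (k : nat) :
  concave_on_R g ->
  ((diff2 g x (dyad R k.+1) / dyad R k.+1 / 4)%:E <=
   \int[@lebesgue_measure R]_(t in dyad_itv R k) (quot2 g x t)%:E)%E.
Proof.
move=> cg; have d0 := dyad_gt0 R k.+1.
set c := diff2 g x (dyad R k.+1) / (4 * dyad R k.+1 ^+ 2).
have -> : diff2 g x (dyad R k.+1) / dyad R k.+1 / 4 = c * dyad R k.+1.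
  by rewrite /c; field; rewrite gt_eqF.
rewrite -integral_dyad_itv_cst; apply: ge0_le_integral => //.
- exact: measurable_itv.
- by move=> t _; rewrite lee_fin divr_ge0 ?diff2_ge0// mulr_ge0 ?sqr_ge0.
- apply: measurable_quot2 => //; first exact: measurable_itv.
  by move=> t; rewrite /dyad_itv /= in_itv/= => /andP[? _]; lra.
- move=> t; rewrite /dyad_itv /= in_itv/= (dyadS R k) => /andP[t1 t2].
  rewrite lee_fin /c /quot2 ler_pM ?diff2_ge0 ?invr_ge0//.
  + by apply: mulr_ge0; rewrite ?sqr_ge0.
  + by apply: diff2_le => //; lra.
  + rewrite lef_pV2 ?posrE; [nra|nra|].
    by rewrite exprn_gt0//; lra.
Qed.

Lemma integral_dyad_itv_le (R : realType) (g : R -> R) (x : R) (k : nat) :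
  concave_on_R g ->
  (\int[@lebesgue_measure R]_(t in dyad_itv R k) (quot2 g x t)%:E <=
   (2 * (diff2 g x (dyad R k) / dyad R k))%:E)%E.
Proof.
move=> cg; have d0 := dyad_gt0 R k.+1.
set c := diff2 g x (dyad R k) / dyad R k.+1 ^+ 2.
have -> : 2 * (diff2 g x (dyad R k) / dyad R k) = c * dyad R k.+1.
  by rewrite /c (dyadS R k); field; rewrite gt_eqF.
rewrite -integral_dyad_itv_cst; apply: ge0_le_integral => //.
- exact: measurable_itv.
- by move=> t _; rewrite lee_fin divr_ge0 ?diff2_ge0// sqr_ge0.
- apply: measurable_quot2 => //; first exact: measurable_itv.
  by move=> t; rewrite /dyad_itv /= in_itv/= => /andP[? _]; lra.
- move=> t; rewrite /dyad_itv /= in_itv/= => /andP[t1 t2].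
  rewrite lee_fin /c /quot2 ler_pM ?diff2_ge0 ?invr_ge0 ?sqr_ge0//.
  + by apply: diff2_le => //; lra.
  + by rewrite lef_pV2 ?posrE ?exprn_gt0//; nra.
Qed.

Definition locally_bounded_dyadic_sums (R : realType) (g : R -> R) : Prop :=
  forall r : R, exists K, forall x n, `|x| <= r -> dyadic_sum g x n <= K.

(** The integral controls only the terms of index [k.+1]; the term of index [0] is bounded because
    [g] is locally bounded. *)
Lemma locally_bounded_second_diff_integralP (R : realType) (g : R -> R) :
  concave_on_R g ->
  locally_bounded_below (second_diff_integral g) <->
  locally_bounded_dyadic_sums g.
Proof.
move=> cg.
have J0 x k : (0 <= \int[@lebesgue_measure R]_(t in dyad_itv R k)
    (quot2 g x t)%:E)%E.
  by apply: integral_ge0 => t _; rewrite lee_fin divr_ge0 ?diff2_ge0 ?sqr_ge0.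
split=> [H r|H B [r Br]].
  have [M HM] := H (fun x => `|x| <= r) (ex_intro _ r (fun x h => h)).
  have [K HK] := convex_bounded (`|r| + 1) (concave_opp cg).
  exists (4 * K + 4 * - M) => x n xr.
  have a0 : diff2 g x (dyad R 0) / dyad R 0 <= 4 * K.
    rewrite /dyad expr0 divr1.
    have rr := ler_norm r.
    have /HK : `|x| <= `|r| + 1 by lra.
    have /HK : `|x + 1| <= `|r| + 1.
      by have := ler_normD x 1; rewrite normr1; lra.
    have /HK : `|x - 1| <= `|r| + 1.
      by have := ler_normB x 1; rewrite normr1; lra.
    by rewrite /diff2 !ler_norml; lra.
  have S4 : \sum_(k < n) diff2 g x (dyad R k.+1) / dyad R k.+1 <= 4 * - M.
    rewrite mulrC -ler_pdivrMr// mulr_suml.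
    have := HM x xr; rewrite second_diff_integralE// leeNr -EFinN.
    rewrite -lee_fin => /(le_trans _); apply.
    apply: le_trans (nneseries_lim_ge n _) => //.
    rewrite big_mkord -sumEFin; apply: lee_sum => k _.
    exact: integral_dyad_itv_ge.
  (* One more nonnegative term is added, so that the sum splits into term [0] and the [n] shifted
     terms. *)
  apply: le_trans (_ : dyadic_sum g x n.+1 <= _); last first.
    by rewrite /dyadic_sum big_ord_recl; apply: lerD.
  rewrite /dyadic_sum big_ord_recr/= lerDl divr_ge0 ?diff2_ge0//.
  exact/ltW/dyad_gt0.
have [K HK] := H r; exists (- (2 * K)) => x Bx.
rewrite second_diff_integralE// EFinN leeN2.
apply: lime_le; first exact: is_cvg_nneseries.
apply: nearW => n; rewrite big_mkord.
apply: le_trans (_ : (2 * dyadic_sum g x n)%:E <= _)%E; last first.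
  by rewrite lee_fin ler_pM2l// HK// Br.
rewrite /dyadic_sum mulr_sumr -sumEFin; apply: lee_sum => k _.
exact: integral_dyad_itv_le.
Qed.

(** * Traces of separately convex functions *)

(** Convexity in [y] reduces the square to its sides [y = r] and [y = - r], on which [f] is convex
    in [x]. *)
Lemma separately_convex_bounded_above (R : realType) (f : R * R -> R) (r : R) :
  separately_convex f -> exists K, forall x y,
  `|x| <= r -> `|y| <= r -> f (x, y) <= K.
Proof.
move=> [fx fy].
have [A HA] := convex_bounded r (fx r).
have [B HB] := convex_bounded r (fx (- r)).
exists (Num.max B A) => x y xr; rewrite ler_norml => /andP[y1 y2].
apply: (le_trans (convex_le_max (fy x) y1 y2)).
rewrite ge_max !le_max; apply/andP; split; apply/orP; [left|right].
  exact: le_trans (ler_norm _) (HB x xr).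
exact: le_trans (ler_norm _) (HA x xr).
Qed.

Definition antidiag2 (R : realType) (f : R * R -> R) (x t : R) : R :=
  f (x + t, x - t) + f (x - t, x + t) - 2 * f (x, x).

(** The difference of the two sides is the sum of [f] over the four corners of the square minus
    [4 * f (x, x)]. *)
Lemma diff2_le_antidiag2 (R : realType) (f : R * R -> R) (x t : R) :
  separately_convex f -> diff2 (fun u => f (u, u)) x t <= antidiag2 f x t.
Proof.
move=> [fx fy]; have := fx x (x + t) (x - t) 2^-1.
have := fy (x + t) (x + t) (x - t) 2^-1.
have := fy (x - t) (x + t) (x - t) 2^-1.
have -> : 2^-1 * (x + t) + (1 - 2^-1) * (x - t) = x by lra.
by rewrite /antidiag2 /diff2; lra.
Qed.

(* From (x + t, x - t), a horizontal move reaches (x - t, x - t) or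
   (x + 2t, x - t), and from the latter a vertical move reaches
   (x + 2t, x + 2t) or (x + 2t, x - 2t); so doubling the distance to the
   diagonal costs a factor 2 in probability. *)
Lemma antidiag2_double (R : realType) (f : R * R -> R) (x t : R) :
  separately_convex f ->
  antidiag2 f x t <= 2^-1 * antidiag2 f x (2 * t)
    - 3^-1 * diff2 (fun u => f (u, u)) x t
    - 6^-1 * diff2 (fun u => f (u, u)) x (2 * t).
Proof.
move=> [fx fy].
have := fx (x - t) (x - t) (x + 2 * t) 3^-1.
have := fx (x + t) (x + t) (x - 2 * t) 3^-1.
have := fy (x + 2 * t) (x + 2 * t) (x - 2 * t) 4^-1.
have := fy (x - 2 * t) (x - 2 * t) (x + 2 * t) 4^-1.
have -> : 3^-1 * (x - t) + (1 - 3^-1) * (x + 2 * t) = x + t by lra.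
have -> : 3^-1 * (x + t) + (1 - 3^-1) * (x - 2 * t) = x - t by lra.
have -> : 4^-1 * (x + 2 * t) + (1 - 4^-1) * (x - 2 * t) = x - t by lra.
have -> : 4^-1 * (x - 2 * t) + (1 - 4^-1) * (x + 2 * t) = x + t by lra.
by rewrite /antidiag2 /diff2; lra.
Qed.

Lemma dyadic_sum_le_antidiag2 (R : realType) (f : R * R -> R) (x : R) (n : nat) :
  separately_convex f -> concave_on_R (fun u => f (u, u)) ->
  dyadic_sum (fun u => f (u, u)) x n <= 4 * antidiag2 f x 1.
Proof.
move=> sf cg; set g := fun u => f (u, u).
have b0 t : 0 <= antidiag2 f x t.
  by apply: le_trans (diff2_le_antidiag2 x t sf); apply: diff2_ge0.
case: n => [|n]; first by rewrite /dyadic_sum big_ord0 mulr_ge0.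
(* The left side does not increase when the scale is halved; at scale [1], [diff2 <= antidiag2]
   gives the constant [1 + 1/3]. *)
suff H : antidiag2 f x (dyad R n) / dyad R n +
    3^-1 * dyadic_sum g x n.+1 <= 4 / 3 * antidiag2 f x 1.
  have := divr_ge0 (b0 (dyad R n)) (ltW (dyad_gt0 R n)); lra.
elim: n => [|n IH].
  rewrite /dyadic_sum big_ord_recl big_ord0 /dyad expr0 !divr1.
  by have := diff2_le_antidiag2 x 1 sf; rewrite -/g; lra.
rewrite /dyadic_sum big_ord_recr/= -/(dyadic_sum g x n.+1).
have d0 := dyad_gt0 R n.+1; move: IH; rewrite (dyadS R n).
set d := dyad R n.+1 in d0 *.
have := antidiag2_double x d sf; rewrite -/g.
have := diff2_ge0 x (2 * d) cg; rewrite -/g.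
set a1 := diff2 g x d; set a2 := diff2 g x (2 * d).
set b1 := antidiag2 f x d; set b2 := antidiag2 f x (2 * d).
move=> a20 H.
have : b1 / d <= (2^-1 * b2 - 3^-1 * a1) / d.
  by rewrite ler_pM2r ?invr_gt0//; lra.
have -> : (2^-1 * b2 - 3^-1 * a1) / d = b2 / (2 * d) - 3^-1 * (a1 / d).
  by field; rewrite gt_eqF.
lra.
Qed.

Lemma trace_bounded_dyadic_sums (R : realType) (f : R * R -> R) :
  separately_convex f -> concave_on_R (fun u => f (u, u)) ->
  locally_bounded_dyadic_sums (fun u => f (u, u)).
Proof.
move=> sf cg r.
have [K HK] := separately_convex_bounded_above (r + 1) sf.
have [L HL] := convex_bounded r (concave_opp cg).
exists (4 * (2 * K + 2 * L)) => x n xr.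
apply: (le_trans (dyadic_sum_le_antidiag2 x n sf cg)).
have A : `|x + 1| <= r + 1 by have := ler_normD x 1; rewrite normr1; lra.
have B : `|x - 1| <= r + 1 by have := ler_normB x 1; rewrite normr1; lra.
have := HK _ _ A B; have := HK _ _ B A; have := HL _ xr.
by rewrite /antidiag2 ler_norml; lra.
Qed.

(** * Saddles and barriers *)

(** A segment from [x] to [y] stays within radius [|x| + |y|]. This serves for locally finite
    sums. *)
Lemma convex_locally (R : realType) (h : R -> R) :
  (forall r, exists2 k, convex_on_R k & forall x, `|x| <= r -> h x = k x) ->
  convex_on_R h.
Proof.
move=> H x y l l0 l1; have [k ck hk] := H (`|x| + `|y|).
rewrite !hk; first exact: ck; rewrite ?lerDl ?lerDr//.
apply: (le_trans (ler_normD _ _)); rewrite !normrM (ger0_norm l0).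
have l1' : 0 <= 1 - l by rewrite subr_ge0.
rewrite (ger0_norm l1'); apply: lerD.
  by rewrite ler_piMl.
by rewrite ler_piMl//; lra.
Qed.

Lemma convex_sqr (R : realType) (h : R -> R) : convex_on_R h ->
  (forall x, 0 <= h x) -> convex_on_R (fun x => h x ^+ 2).
Proof.
move=> ch h0 x y l l0 l1; have H := ch x y l l0 l1.
have l1' : 0 <= 1 - l by rewrite subr_ge0.
apply: le_trans (_ : (l * h x + (1 - l) * h y) ^+ 2 <= _).
  by apply: lerXn2r; rewrite ?nnegrE// addr_ge0 ?mulr_ge0.
have := mulr_ge0 (mulr_ge0 l0 l1') (sqr_ge0 (h x - h y)); lra.
Qed.

Lemma convex_sup (R : realType) (I : Type) (F : I -> R -> R) (i0 : I) :
  (forall i, convex_on_R (F i)) ->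
  (forall x, exists B, forall i, F i x <= B) ->
  convex_on_R (fun x => sup (range (fun i => F i x))).
Proof.
move=> cF bF x y l l0 l1.
have ub z i : F i z <= sup (range (fun i => F i z)).
  apply: ub_le_sup; last by exists i.
  by have [B HB] := bF z; exists B => _ [j _ <-].
apply: ge_sup; first by exists (F i0 (l * x + (1 - l) * y)), i0.
move=> _ [i _ <-]; apply: (le_trans (cF i x y l l0 l1)).
by apply: lerD; apply: ler_wpM2l; rewrite ?subr_ge0.
Qed.

Lemma separately_convex_sym (R : realType) (f : R * R -> R) :
  (forall x y, f (x, y) = f (y, x)) ->
  (forall y, convex_on_R (fun x => f (x, y))) -> separately_convex f.
Proof.
by move=> fC fx; split=> // x; apply: eq_convex (fx x) => y; apply: fC.
Qed.

Definition saddle (R : realType) (x y : R) : R :=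
  if (`|x| <= 1) && (`|y| <= 1) then - (x * y) else `|x - y| - 1.

Lemma saddleC (R : realType) (x y : R) : saddle x y = saddle y x.
Proof. by rewrite /saddle andbC mulrC distrC. Qed.

(** For [|y| <= 1] the slice is the maximum of [- (x * y)] and [|x - y| - 1], which meet at
    [|x| = 1]; otherwise it is the latter alone. *)
Lemma saddle_convex (R : realType) (y : R) : convex_on_R (fun x => saddle x y).
Proof.
have cd : convex_on_R (fun x => `|x - y| - 1).
  apply: (eq_convex (h := fun x => `|x - y| + (0 * x + -1))).
    by move=> x; lra.
  by apply: convexD; [exact: convex_dist|exact: convex_affine].
have [y1|y1] := leP `|y| 1; last first.
  by apply: eq_convex cd => x; rewrite /saddle (leNgt `|y|) y1 andbF.
apply: eq_convex (convex_max (convex_affine (- y) 0) cd) => x.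
rewrite /saddle y1 andbT; move: y1; rewrite ler_norml => /andP[ya yb].
have -> : - y * x + 0 = - (x * y) by ring.
have [x1|x1] := leP `|x| 1.
  move: x1; rewrite ler_norml => /andP[xa xb]; apply: max_l.
  by have [xy|xy] := ger0P (x - y); nra.
apply: max_r; move: x1; have [xy|xy] := ger0P (x - y).
- by have [x0|x0] := ger0P x => x1; nra.
- by have [x0|x0] := ger0P x => x1; nra.
Qed.

Lemma saddle_le_dist (R : realType) (x y : R) : saddle x y <= `|x - y|.
Proof.
rewrite /saddle; case: ifP => [/andP[]|_]; last by rewrite gerBl.
rewrite !ler_norml => /andP[xa xb] /andP[ya yb].
by have [xy|xy] := ger0P (x - y); nra.
Qed.

Lemma saddle_diag_le0 (R : realType) (u : R) : saddle u u <= 0.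
Proof.
rewrite /saddle subrr normr0; case: ifP => _; last by lra.
by rewrite oppr_le0 -expr2 sqr_ge0.
Qed.

(** The gain [4^-1] is what the factor [4] in [minorant] compensates. *)
Lemma saddle_diag_le (R : realType) (u : R) :
  2^-1 <= `|u| -> saddle u u <= - 4^-1.
Proof.
move=> u2; rewrite /saddle subrr normr0; case: ifP => _; last by lra.
by rewrite -expr2 -real_normK ?num_real//; nra.
Qed.

(** * The barrier: a locally finite sum of truncated saddles *)

Definition wedge (R : realType) (x y : R) : R :=
  if (x <= 0) && (y <= 0) then 0 else - (x * y).

Lemma wedgeC (R : realType) (x y : R) : wedge x y = wedge y x.
Proof. by rewrite /wedge andbC mulrC. Qed.

Lemma wedge_convex (R : realType) (y : R) : convex_on_R (fun x => wedge x y).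
Proof.
have [y0|y0] := leP y 0; last first.
  apply: eq_convex (convex_affine (- y) 0) => x.
  by rewrite /wedge (leNgt y) y0 andbF; ring.
apply: eq_convex (convex_max (convex_affine 0 0) (convex_affine (- y) 0)) => x.
have -> : 0 * x + 0 = 0 by ring.
have -> : - y * x + 0 = - (x * y) by ring.
rewrite /wedge y0 andbT; have [x0|x0] := leP x 0.
  by apply: max_l; nra.
by apply: max_r; nra.
Qed.

Lemma wedge_diag_convex (R : realType) : convex_on_R (fun u : R => - wedge u u).
Proof.
have c := convex_max (convex_affine (1 : R) 0) (convex_affine 0 0).
apply: eq_convex (convex_sqr c _) => u; last first.
  by rewrite le_max; apply/orP; right; lra.
have -> : 0 * u + 0 = 0 by ring.
rewrite mul1r addr0 /wedge; have [u0|u0] := leP u 0 => /=.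
  by rewrite expr0n oppr0.
by rewrite opprK expr2.
Qed.

Definition barrier_term (R : realType) (k : nat) (x y : R) : R :=
  wedge (x - k%:R) (y - k%:R) + wedge (- x - k%:R) (- y - k%:R).

(* For [|x|, |y| <= k] the k-th term vanishes, so the weights [c] are arbitrary
   and the trace can be made to decrease as fast as desired. *)
Definition barrier_sum (R : realType) (c : nat -> R) (n : nat) (x y : R) : R :=
  \sum_(k < n) c k * barrier_term k x y.

(** An infinite sum, encoded by a number of terms that depends on the point: all omitted terms
    vanish there. *)
Definition barrier (R : realType) (c : nat -> R) (z : R * R) : R :=
  barrier_sum c (Num.bound (`|z.1| + `|z.2|)) z.1 z.2.

Lemma barrier_term_convex (R : realType) (k : nat) (y : R) :
  convex_on_R (fun x => barrier_term k x y).
Proof.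
apply: convexD.
  apply: eq_convex (convex_comp_affine 1 (- k%:R) (wedge_convex (y - k%:R))).
  by move=> x; rewrite mul1r.
apply: eq_convex (convex_comp_affine (-1) (- k%:R) (wedge_convex (- y - k%:R))).
by move=> x; rewrite mulN1r.
Qed.

Lemma barrier_term_diag_convex (R : realType) (k : nat) :
  convex_on_R (fun u : R => - barrier_term k u u).
Proof.
apply: (eq_convex (h := fun u => - wedge (1 * u - k%:R) (1 * u - k%:R)
  + - wedge (-1 * u - k%:R) (-1 * u - k%:R))).
  by move=> u; rewrite /barrier_term mul1r mulN1r opprD.
by apply: convexD; apply: (convex_comp_affine _ _ (@wedge_diag_convex R)).
Qed.

Lemma barrierE (R : realType) (c : nat -> R) (n : nat) (x y : R) :
  `|x| <= n%:R -> `|y| <= n%:R -> barrier c (x, y) = barrier_sum c n x y.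
Proof.
have stab m p : `|x| <= m%:R -> `|y| <= m%:R -> (m <= p)%N ->
    barrier_sum c p x y = barrier_sum c m x y.
  move=> xm ym; elim: p => [|p IH]; first by rewrite leqn0 => /eqP ->.
  rewrite leq_eqVlt => /predU1P[->//|]; rewrite ltnS => mp.
  rewrite /barrier_sum big_ord_recr/= -/(barrier_sum c p x y) IH//.
  have mp' : m%:R <= p%:R :> R by rewrite ler_nat.
  have := le_trans xm mp'; have := le_trans ym mp'.
  rewrite !ler_norml => /andP[ya yb] /andP[xa xb].
  rewrite /barrier_term /wedge !ifT ?addr0 ?mulr0 ?addr0//;
    by apply/andP; split; lra.
move=> xn yn; rewrite /barrier /=; set b := Num.bound _.
have xyb : `|x| + `|y| < b%:R by apply: archi_boundP; apply: addr_ge0.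
have xb : `|x| <= b%:R by have := normr_ge0 y; lra.
have yb : `|y| <= b%:R by have := normr_ge0 x; lra.
(* Both truncations agree with the one at [maxn b n]. *)
by rewrite -(stab b (maxn b n))// ?leq_maxl// (stab n)// leq_maxr.
Qed.

Lemma barrier_separately_convex (R : realType) (c : nat -> R) :
  (forall k, 0 <= c k) -> separately_convex (barrier c).
Proof.
move=> c0; apply: separately_convex_sym => [x y|y].
  rewrite /barrier /= addrC; apply: eq_bigr => k _.
  by rewrite /barrier_term wedgeC (wedgeC (- x - _)).
apply: convex_locally => r; set n := Num.bound (`|r| + `|y|).
have rn : `|r| + `|y| < n%:R by apply: archi_boundP; apply: addr_ge0.
exists (fun x => barrier_sum c n x y).
  apply: convex_sum => k; apply: convexZ => //; exact: barrier_term_convex.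
move=> x xr; apply: barrierE.
  by have := ler_norm r; have := normr_ge0 y; lra.
by have := normr_ge0 r; lra.
Qed.

(** Each negated wedge is a squared positive part on the diagonal. The resulting supporting lines
    give slopes for [g] minus the barrier. *)
Lemma barrier_diag_convex (R : realType) (c : nat -> R) :
  (forall k, 0 <= c k) -> convex_on_R (fun u => - barrier c (u, u)).
Proof.
move=> c0; apply: convex_locally => r; set n := Num.bound `|r|.
have rn : `|r| < n%:R by apply: archi_boundP.
exists (fun u => \sum_(k < n) c k * - barrier_term k u u).
  by apply: convex_sum => k; apply: convexZ => //;
    exact: barrier_term_diag_convex.
move=> u ur; rewrite (@barrierE _ _ n); first last.
- by have := ler_norm r; lra.
- by have := ler_norm r; lra.
by rewrite /barrier_sum -sumrN; apply: eq_bigr => k _; rewrite mulrN.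
Qed.

Lemma barrier_term_diag_le0 (R : realType) (k : nat) (u : R) :
  barrier_term k u u <= 0.
Proof.
have w0 v : wedge v v <= 0 :> R.
  by rewrite /wedge; case: ifP => // _; rewrite oppr_le0 -expr2 sqr_ge0.
by rewrite /barrier_term; have := w0 (u - k%:R); have := w0 (- u - k%:R); lra.
Qed.

Lemma barrier_term_diag_le (R : realType) (k : nat) (u : R) :
  k.+1%:R <= `|u| -> barrier_term k u u <= -1.
Proof.
rewrite -natr1 /barrier_term /wedge !andbb.
have k0 : 0 <= k%:R :> R by [].
have [u0|u0] := ger0P u => ku.
  by rewrite ifF ?ifT; [nra|lra|apply/negbTE; rewrite -ltNge; lra].
by rewrite ifT ?ifF; [nra|apply/negbTE; rewrite -ltNge; lra|lra].
Qed.

(** The weight [c k] bounds [|g|] for [|u| <= k + 2]. If [k + 1 <= |u| < k + 2], the [k]-th term is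
    at most [- c k] and the others are nonpositive. *)
Lemma barrier_dominates (R : realType) (g : R -> R) : concave_on_R g ->
  exists c : nat -> R, (forall k, 0 <= c k) /\
  exists K, forall u, - K <= g u - barrier c (u, u).
Proof.
move=> cg.
have /choice[c Hc] : forall k : nat, exists c : R,
    forall u, `|u| <= k.+2%:R -> `|- g u| <= c.
  by move=> k; apply: convex_bounded; apply: concave_opp.
have c0 k : 0 <= c k by apply: le_trans (Hc k 0 _); rewrite ?normr0.
exists c; split=> //; exists (c 0%N) => u.
set n := Num.bound `|u|; have un : `|u| < n%:R by apply: archi_boundP.
rewrite (barrierE _ (ltW un) (ltW un)) /barrier_sum.
have T k : c k * barrier_term k u u <= 0.
  by rewrite mulr_ge0_le0// barrier_term_diag_le0.
have [u1|u1] := ltP `|u| 1.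
  have /Hc : `|u| <= 2%:R by lra.
  have : \sum_(k < n) c k * barrier_term k u u <= 0 by apply: sumr_le0.
  by rewrite ler_norml; lra.
have /andP[m1 m2] := truncn_itv (normr_ge0 u).
have mn : (0 < Num.trunc `|u|)%N by rewrite truncn_gt0.
move: m1 m2; case: (Num.trunc `|u|) mn => // k _ m1 m2.
have kn : (k < n)%N.
  by rewrite -(ltr_nat R); move: m1; rewrite -natr1; lra.
rewrite (bigD1 (Ordinal kn))//=.
have S : \sum_(i < n | i != Ordinal kn) c i * barrier_term i u u <= 0.
  by apply: sumr_le0.
have /Hc : `|u| <= k.+2%:R by exact: ltW.
have := ler_wpM2l (c0 k) (barrier_term_diag_le m1).
have := c0 0%N; rewrite ler_norml; lra.
Qed.

(** * The supremum of minorants *)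

(** The tangent at [u] is corrected at three ranges of distance: saddles at the scales [2^-k], the
    constant [a u n] below the last scale, the bilinear term beyond distance [1]. *)
Definition minorant (R : realType) (g p M : R -> R) (a : R -> nat -> R)
    (u : R) (n : nat) (x y : R) : R :=
  g u + p u * ((x + y) / 2 - u)
  + 4 * (\sum_(k < n) a u k * saddle ((x - u) / dyad R k) ((y - u) / dyad R k))
  - a u n - M u * ((x - u) * (y - u)).

Lemma minorantC (R : realType) (g p M : R -> R) (a : R -> nat -> R)
    (u : R) (n : nat) (x y : R) :
  minorant g p M a u n x y = minorant g p M a u n y x.
Proof.
rewrite /minorant (addrC x y) (mulrC (x - u)); congr (_ + 4 * _ - _ - _).
by apply: eq_bigr => k _; rewrite saddleC.
Qed.

Lemma minorant_convex (R : realType) (g p M : R -> R) (a : R -> nat -> R)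
    (u : R) (n : nat) (y : R) : (forall k, 0 <= a u k) ->
  convex_on_R (fun x => minorant g p M a u n x y).
Proof.
move=> a0; pose S x := \sum_(k < n) a u k *
  saddle ((dyad R k)^-1 * x + - u / dyad R k) ((y - u) / dyad R k).
apply: (eq_convex (h := fun x =>
    (((p u) / 2 - M u * (y - u)) * x +
     (g u + p u * (y / 2 - u) - a u n + M u * (u * (y - u)))) + 4 * S x)).
  move=> x; rewrite /minorant.
  have -> : S x = \sum_(k < n) a u k *
      saddle ((x - u) / dyad R k) ((y - u) / dyad R k).
    by apply: eq_bigr => k _; congr (_ * saddle _ _); ring.
  by set s := \sum_(k < n) _; lra.
apply: convexD; first exact: convex_affine.
apply: convexZ => //; apply: convex_sum => k; apply: convexZ => //.
exact: (convex_comp_affine _ _ (saddle_convex ((y - u) / dyad R k))).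
Qed.

(** The rescaled saddles are at most [|x - y| / 2^-k], so their weighted sum is bounded by
    [C u * |x - y|], uniformly in [n]. *)
Lemma minorant_le (R : realType) (g p M C : R -> R) (a : R -> nat -> R)
    (u : R) (n : nat) (x y : R) : (forall k, 0 <= a u k) ->
  \sum_(k < n) a u k / dyad R k <= C u ->
  minorant g p M a u n x y <= `|g u| + `|p u| * (`|x| + `|y| + `|u|)
     + 4 * C u * (`|x| + `|y|) - M u * ((x - u) * (y - u)).
Proof.
move=> a0 aC; rewrite /minorant.
have A := ler_norm (g u).
have B : p u * ((x + y) / 2 - u) <= `|p u| * (`|x| + `|y| + `|u|).
  apply: (le_trans (ler_norm _)); rewrite normrM ler_wpM2l//.
  have := ler_norm x; have := ler_norm y; have := ler_norm u.
  have := ler_norm (- x); have := ler_norm (- y); have := ler_norm (- u).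
  by rewrite !normrN ler_norml; lra.
have D : \sum_(k < n) a u k * saddle ((x - u) / dyad R k) ((y - u) / dyad R k)
    <= C u * (`|x| + `|y|).
  apply: le_trans (_ : (\sum_(k < n) a u k / dyad R k) * `|x - y| <= _).
    rewrite mulr_suml; apply: ler_sum => k _; rewrite -mulrA ler_wpM2l//.
    apply: (le_trans (saddle_le_dist _ _)).
    have -> : (x - u) / dyad R k - (y - u) / dyad R k = (dyad R k)^-1 * (x - y).
      by ring.
    by rewrite normrM gtr0_norm// invr_gt0 dyad_gt0.
  apply: ler_pM => //; last exact: ler_normB.
  by apply: sumr_ge0 => k _; apply: divr_ge0 => //; apply/ltW/dyad_gt0.
by have := a0 n; lra.
Qed.

Lemma minorant_diag_le (R : realType) (g p M : R -> R) (a : R -> nat -> R)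
    (K u v : R) (n : nat) : (forall k, 0 <= a u k) ->
  (forall v, - K <= g v) ->
  (forall k, `|v - u| <= dyad R k -> g u + p u * (v - u) - a u k <= g v) ->
  `|g u| + `|K| + `|p u| <= M u ->
  minorant g p M a u n v v <= g v.
Proof.
move=> a0 gK ga hM; rewrite /minorant.
have -> : (v + v) / 2 = v by lra.
rewrite -expr2 -[X in M u * X]real_normK ?num_real//.
set t := v - u in ga *; set S := \sum_(k < n) _.
have T k : a u k * saddle (t / dyad R k) (t / dyad R k) <= 0.
  by rewrite mulr_ge0_le0// saddle_diag_le0.
have S0 : S <= 0 by apply: sumr_le0.
have M0 : 0 <= M u by apply: le_trans hM; rewrite !addr_ge0.
have Mt : 0 <= M u * `|t| ^+ 2 by rewrite mulr_ge0 ?sqr_ge0.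
(* Beyond distance [1], [1 <= |t| <= |t| ^+ 2], so [M u * |t| ^+ 2] absorbs the tangent and the
   lower bound [- K]. *)
have [t1|t1] := leP `|t| 1; last first.
  have pt : p u * t <= `|p u| * `|t| by rewrite -normrM ler_norm.
  have tt : `|t| <= `|t| ^+ 2 by rewrite expr2 ler_pMr; lra.
  have Q1 : (`|g u| + `|K| + `|p u|) * `|t| ^+ 2 <= M u * `|t| ^+ 2.
    by rewrite ler_wpM2r ?sqr_ge0.
  have Q2 : `|p u| * `|t| <= `|p u| * `|t| ^+ 2 by rewrite ler_wpM2l.
  have Q3 : `|g u| + `|K| <= (`|g u| + `|K|) * `|t| ^+ 2.
    by rewrite ler_peMr ?addr_ge0//; lra.
  have := gK v; have := ler_norm (g u); have := ler_norm K; have := a0 n.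
  lra.
have [tn|tn] := leP `|t| (dyad R n); first by have := ga _ tn; lra.
(* The saddle at the scale of [|t|] alone contributes at most [- a u k], the allowed tangent error;
   the others are nonpositive. *)
have [k kn /andP[kt tk]] := dyad_between t1 tn.
have := ga _ tk; rewrite /S (bigD1 (Ordinal kn))//=.
have d0 := dyad_gt0 R k.
have : a u k * saddle (t / dyad R k) (t / dyad R k) <= a u k * - 4^-1.
  rewrite ler_wpM2l// saddle_diag_le// normrM (gtr0_norm (x := _^-1)) ?invr_gt0//.
  by rewrite ler_pdivlMr//; have := dyadS R k; lra.
have : \sum_(i < n | i != Ordinal kn)
    a u i * saddle (t / dyad R i) (t / dyad R i) <= 0 by apply: sumr_le0.
by have := a0 n; lra.
Qed.

(* [g] need not be concave: [p u] is a slope for which the tangent line at [u]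
   exceeds [g] by at most [a u k] at distance [2^-k]. *)
Lemma exists_separately_convex_trace (R : realType) (g p : R -> R)
    (a : R -> nat -> R) (K : R) :
  (forall r, exists L, forall u, `|u| <= r -> `|g u| <= L /\ `|p u| <= L) ->
  (forall u, - K <= g u) ->
  (forall u k, 0 <= a u k) ->
  (forall u v k, `|v - u| <= dyad R k -> g u + p u * (v - u) - a u k <= g v) ->
  (forall r, exists L, forall u n, `|u| <= r ->
     \sum_(k < n) a u k / dyad R k <= L) ->
  exists f : R * R -> R, separately_convex f /\ forall u, f (u, u) = g u.
Proof.
move=> gpb gK a0 ga sb.
pose S u n : R := \sum_(k < n) a u k / dyad R k.
pose C u : R := sup (range (S u)).
have SC u n : S u n <= C u.
  apply: ub_le_sup; last by exists n.
  by have [L HL] := sb `|u|; exists L => _ [m _ <-]; apply: HL.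
have C0 u : 0 <= C u by have := SC u 0%N; rewrite /S big_ord0.
have Cb r : exists L, forall u, `|u| <= r -> C u <= L.
  have [L HL] := sb r; exists L => u ur; apply: ge_sup.
    by exists (S u 0%N), 0%N.
  by move=> _ [m _ <-]; apply: HL.
(* [M u] dominates the other terms of the minorant at [(x, y)] as soon as
   [|u| >= |x| + |y| + 1]. *)
pose M u := `|g u| + `|K| + `|p u| * (1 + 2 * `|u|) + 4 * C u * `|u|.
have M0 u : 0 <= M u by rewrite /M !addr_ge0// !mulr_ge0// addr_ge0// mulr_ge0.
pose F (i : R * nat) (x y : R) := minorant g p M a i.1 i.2 x y.
(* Finiteness of the supremum: centres with [|u| <= r + 1] have uniformly bounded data, and remote
   ones give nonpositive values. *)
have Fb x y : exists B, forall i, F i x y <= B.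
  set r := `|x| + `|y|; have r0 : 0 <= r by apply: addr_ge0.
  have [L HL] := gpb (r + 1); have [L' HL'] := Cb (r + 1).
  pose m := L + `|K| + L * (1 + 2 * (r + 1)) + 4 * L' * (r + 1).
  exists (L + L * (r + (r + 1)) + 4 * L' * r + m * (2 * r + 1) ^+ 2).
  move=> [u n]; apply: (le_trans (minorant_le g p M x y (a0 u) (SC u n))).
  rewrite -/r /=; have [ur|ur] := leP `|u| (r + 1).
    have [gL pL] := HL u ur; have CL := HL' u ur.
    have g0 := normr_ge0 (g u); have p0 := normr_ge0 (p u).
    have K0 := normr_ge0 K; have u0 := normr_ge0 u.
    have L0 : 0 <= L by lra.
    have L0' : 0 <= L' by apply: le_trans CL.
    have Q1 : `|p u| * (r + `|u|) <= L * (r + (r + 1)).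
      by apply: ler_pM => //; lra.
    have Q2 : 4 * C u * r <= 4 * L' * r by rewrite ler_wpM2r//; lra.
    have Q3 : `|p u| * (1 + 2 * `|u|) <= L * (1 + 2 * (r + 1)).
      by apply: ler_pM => //; lra.
    have Q4 : 4 * C u * `|u| <= 4 * L' * (r + 1).
      by apply: ler_pM => //; [have := C0 u; lra|lra].
    have Mm : M u <= m by rewrite /M /m; lra.
    have Q5 : - (M u * ((x - u) * (y - u))) <= m * (2 * r + 1) ^+ 2.
      apply: (le_trans (ler_norm _)); rewrite normrN normrM ger0_norm//.
      apply: ler_pM => //; rewrite normrM expr2.
      have := normr_ge0 x; have := normr_ge0 y.
      have := ler_normB x u; have := ler_normB y u.
      by rewrite /r in ur *; move=> *; apply: ler_pM => //; lra.
    lra.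
  (* For [|u| > |x| + |y| + 1] both factors have the same sign and modulus at least [1]. *)
  suff H : 1 <= (x - u) * (y - u).
    have Q0 : M u <= M u * ((x - u) * (y - u)) by rewrite ler_peMr.
    have Q1 : `|p u| * (r + `|u|) <= `|p u| * (1 + 2 * `|u|).
      by rewrite ler_wpM2l//; lra.
    have Q2 : 4 * C u * r <= 4 * C u * `|u|.
      by rewrite ler_wpM2l//; [have := C0 u; lra|lra].
    have K0 := normr_ge0 K.
    (* The bounds at the centre [0] show that [L] and [L'] are nonnegative. *)
    have rhs0 : 0 <= L + L * (r + (r + 1)) + 4 * L' * r + m * (2 * r + 1) ^+ 2.
      have z : `|0 : R| <= r + 1 by rewrite normr0; lra.
      have [gL _] := HL 0 z; have CL := HL' 0 z.
      have L0 : 0 <= L by apply: le_trans gL.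
      have L0' : 0 <= L' by apply: le_trans CL.
      have Lr q : 0 <= q -> 0 <= L * q by exact: mulr_ge0.
      have Lr' q : 0 <= q -> 0 <= 4 * L' * q.
        by move=> q0; rewrite !mulr_ge0.
      have m0 : 0 <= m.
        have A : 0 <= 1 + 2 * (r + 1) by lra.
        have B : 0 <= r + 1 by lra.
        by have := Lr _ A; have := Lr' _ B; rewrite /m; lra.
      have A : 0 <= r + (r + 1) by lra.
      have B := mulr_ge0 m0 (sqr_ge0 (2 * r + 1)).
      by have := Lr _ A; have := Lr' _ r0; lra.
    by move: Q0; rewrite {1}/M; lra.
  rewrite /r in ur; have x1 := ler_norm x; have y1 := ler_norm y.
  have x2 := ler_norm (- x); have y2 := ler_norm (- y).
  have x0 := normr_ge0 x; have y0 := normr_ge0 y; rewrite !normrN in x2 y2.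
  move: ur; have [u0|u0] := ger0P u => ur.
    by rewrite -mulrNN mulr_ege1; lra.
  by rewrite mulr_ege1; lra.
exists (fun z => sup (range (fun i => F i z.1 z.2))); split.
  apply: separately_convex_sym => [x y|y] /=.
    suff -> : (fun i => F i x y) = (fun i => F i y x) by [].
    by apply/funext => i; apply: minorantC.
  apply: (convex_sup (F := fun i x => F i x y) (0, 0%N)) => [i|x //].
  exact: minorant_convex.
move=> u /=; apply/eqP; rewrite eq_le; apply/andP; split.
  apply: ge_sup; first by exists (F (0, 0%N) u u), (0, 0%N).
  move=> _ [[v n] _ <-]; apply: (minorant_diag_le (K := K)) => //=.
    by move=> k; apply: ga.
  rewrite /M; have := mulr_ge0 (normr_ge0 (p v)) (normr_ge0 v).
  by have := mulr_ge0 (C0 v) (normr_ge0 v); lra.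
(* At [(u, u)] the n-th minorant equals [g u - a u n], and [a u n <= C u / 2^n]. *)
apply/ler_addgt0Pr => e e0.
have d1 : 0 < e / (C u + 1) by apply: divr_gt0 => //; have := C0 u; lra.
have [n nd] := dyad_lt d1; have dn0 := dyad_gt0 R n.
have ae : a u n <= e.
  have : a u n / dyad R n <= C u.
    apply: le_trans (SC u n.+1); rewrite /S big_ord_recr/= lerDr.
    by apply: sumr_ge0 => k _; apply: divr_ge0 => //; apply/ltW/dyad_gt0.
  rewrite ler_pdivrMr//; move: nd; rewrite ltr_pdivlMr; last first.
    by have := C0 u; lra.
  by lra.
suff : F (u, n) u u <= sup (range (fun i => F i u u)).
  rewrite {1}/F /minorant /= subrr !mul0r mulr0 subr0.
  have -> : (u + u) / 2 - u = 0 by lra.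
  rewrite big1 ?mulr0 ?addr0; first by lra.
  move=> k _; rewrite !mul0r /saddle normr0 ler01/= mulr0 oppr0 mulr0 //.
apply: ub_le_sup; last by exists (u, n).
by have [B HB] := Fb u u; exists B => _ [j _ <-].
Qed.

(** * Reduction to a trace bounded below, and conclusion *)

Lemma separately_convexD (R : realType) (f k : R * R -> R) :
  separately_convex f -> separately_convex k ->
  separately_convex (fun z => f z + k z).
Proof. by move=> [f1 f2] [k1 k2]; split=> z; apply: convexD. Qed.

(** Subtracting the barrier makes the trace bounded below. Minus the barrier is convex on the
    diagonal, so the tangent error comes from [g] alone and is a second difference of [g]. *)
Lemma concave_trace_exists (R : realType) (g : R -> R) : concave_on_R g ->
  locally_bounded_dyadic_sums g ->
  exists f : R * R -> R, separately_convex f /\ forall u, f (u, u) = g u.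
Proof.
move=> cg sb; have [c [c0 [K HK]]] := barrier_dominates cg.
have cG := barrier_diag_convex c0.
have cN := concave_opp cg.
have [p Hp] := convex_subgradient cN; have [q Hq] := convex_subgradient cG.
have [|||||f [sf fg]] := @exists_separately_convex_trace R
  (fun u => g u - barrier c (u, u)) (fun u => q u - p u)
  (fun u k => diff2 g u (dyad R k)) K.
- move=> r; have [L1 H1] := convex_bounded r cN.
  have [L2 H2] := convex_bounded r cG.
  have [L3 H3] := subgradient_bounded r cN Hp.
  have [L4 H4] := subgradient_bounded r cG Hq.
  exists (L1 + L2 + L3 + L4) => u ur.
  have := H1 u ur; have := H2 u ur; have := H3 u ur; have := H4 u ur.
  by rewrite !ler_norml; lra.
- exact: HK.
- by move=> u k; apply: diff2_ge0.
- move=> u v k vk; set t := v - u in vk *.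
  have : diff2 g u t <= diff2 g u (dyad R k).
    have -> : diff2 g u t = diff2 g u `|t|.
      by have [t0|t0] := ger0P t => //; rewrite /diff2 opprK; ring.
    exact: diff2_le.
  (* The supporting line of [- g] is tested at the point [u - t] opposite to [v], which brings in
     the second difference. *)
  have := Hp u (u - t); have := Hq u v; rewrite -/t.
  have -> : u - t - u = - t by ring.
  by rewrite /diff2 /t (addrC u (v - u)) subrK; lra.
- exact: sb.
exists (fun z => f z + barrier c z); split.
  by apply: separately_convexD => //; apply: barrier_separately_convex.
by move=> u; rewrite fg subrK.
Qed.

Theorem theorem1p1 (R : realType) (g : R -> R) (hg : concave_on_R g) :
  (exists f : R * R -> R, separately_convex f /\ forall u : R, f (u, u) = g u)
  <-> locally_bounded_below (second_diff_integral g).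
Proof.
split=> [[f [sf fg]]|/(locally_bounded_second_diff_integralP hg)]; last first.
  exact: concave_trace_exists.
apply/(locally_bounded_second_diff_integralP hg).
have e : (fun u => f (u, u)) = g by apply/funext.
by rewrite -e; apply: trace_bounded_dyadic_sums => //; rewrite e.
Qed.
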